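(* Let $(M^{2n+1},\phi,\xi,\eta,g)$ be a contact metric manifold endowed with a Legendrian distribution $L$, let $Q=\phi L$ be its conjugate Legendrian distribution, and let $\nabla$ be the bi-Legendrian connection associated to $(L,Q)$. Assume that both $L$ and $Q$ are flat and that $\nabla g=0$ (equivalently $\nabla\phi=0$). Then $\nabla$ coincides with the Tanaka-Webster connection $^{\ast}\nabla$ of $(M^{2n+1},\phi,\xi,\eta,g)$ if and only if $L$ and $Q$ are integrable and $(M^{2n+1},\phi,\xi,\eta,g)$ is a Sasakian manifold.
   Context: All manifolds are smooth and connected; $\Gamma(\cdot)$ denotes smooth sections. Convention: $2d\eta(V,W)=V(\eta(W))-W(\eta(V))-\eta([V,W])$. A contact form on $M^{2n+1}$ is a 1-form $\eta$ with $\eta\wedge(d\eta)^n\neq0$ everywhere; its Reeb vector field $\xi$ is determined by $\eta(\xi)=1$, $d\eta(\xi,\cdot)=0$; $\mathcal D=\ker\eta$. A contact metric structure $(\phi,\xi,\eta,g)$ consists of a contact form $\eta$ with Reeb field $\xi$, a Riemannian metric $g$ with $g(V,\xi)=\eta(V)$ and a $(1,1)$-tensor $\phi$ with $\phi^2=-I+\eta\otimes\xi$ and $d\eta(V,W)=g(V,\phi W)$. Set $h=\frac12\mathcal L_\xi\phi$; $\hat\nabla$ is the Levi Civita connection of $g$. The manifold is Sasakian if $[\phi,\phi]+2d\eta\otimes\xi=0$, equivalently $(\hat\nabla_V\phi)W=g(V,W)\xi-\eta(W)V$ for all $V,W$. The (generalized) Tanaka-Webster connection is $^{\ast}\nabla_VW=\hat\nabla_VW+\eta(V)\phi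 W+\eta(W)(\phi V+\phi hV)+d\eta(V+hV,W)\xi$. A Legendrian distribution is an $n$-dimensional subbundle $L\subset\mathcal D$ with $d\eta(X,X')=0$ for all $X,X'\in\Gamma(L)$; it is flat if $[\xi,X]\in\Gamma(L)$ for all $X\in\Gamma(L)$. Its conjugate $Q=\phi L$ is again Legendrian and $TM=L\oplus Q\oplus\mathbb R\xi$ orthogonally. Subscripts denote projections onto the corresponding subbundles. Bi-Legendrian connection of a pair $(L_1,L_2)$ of transversal Legendrian distributions (so $TM=L_1\oplus L_2\oplus\mathbb R\xi$): for vector fields $V,W$ let $H(V,W)\in\Gamma(\mathcal D)$ be the unique section with $d\eta(H(V,W),Z)=V(d\eta(W,Z))-d\eta(W,[V,Z])$ for all $Z\in\Gamma(\mathcal D)$. Then for $X\in\Gamma(L_1)$, $Y\in\Gamma(L_2)$, $f\in C^\infty(M)$ and any vector field $W$, $\nabla_WX=H(W_{L_1},X)_{L_1}+[W_{L_2},X]_{L_1}+[W_{\mathbb R\xi},X]_{L_1}$, $\nabla_WY=H(W_{L_2},Y)_{L_2}+[W_{L_1},Y]_{L_2}+[W_{\mathbb R\xi},Y]_{L_2}$, $\nabla_W(f\xi)=W(f)\xi$. It preserves $L_1,L_2,\mathbb R\xi$, satisfies $\nabla d\eta=0$, $\nabla\xi=0$, and its torsion satisfies $T(X,Y)=2d\eta(X,Y)\xi$ for $X\in\Gamma(L_1),Y\in\Gamma(L_2)$ and $T(V,\xi)=[\xi,V_{L_1}]_{L_2}+[\xi,V_{L_2}]_{L_1}$ for all $V$.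 *)

(* Defs.v *)
From HB Require Import structures.
From mathcomp Require Import all_boot all_order all_fingroup all_algebra.
From mathcomp Require Import all_classical all_reals all_analysis.
From mathcomp Require Import ring.

Set Implicit Arguments.
Unset Strict Implicit.
Unset Printing Implicit Defensive.

Import Order.TTheory GRing.Theory Num.Theory.
Import numFieldNormedType.Exports.

Local Open Scope classical_set_scope.
Local Open Scope ring_scope.

(** * Smooth functions on open subsets of Euclidean space *)

(* [Ck k U f]: f has continuous partial derivatives up to order k on U.  It is
   only used on open sets U. *)
Fixpoint Ck (R : realType) (d k : nat) (U : set 'rV[R]_d.+1)
    (f : 'rV[R]_d.+1 -> R) : Prop :=
  (forall x, U x -> {for x, continuous f}) /\
  (if k is k'.+1 then
     forall i : 'I_d.+1,
       (forall x, U x -> derivable f x ('e_i : 'rV[R]_d.+1)) /\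
       Ck k' U (fun x => 'D_('e_i : 'rV[R]_d.+1) f x)
   else True).

Definition smooth_on (R : realType) (d : nat) (U : set 'rV[R]_d.+1)
  (f : 'rV[R]_d.+1 -> R) : Prop := forall k, Ck k U f.

Section EuclideanSmooth.
Context {R : realType} {d : nat}.
Implicit Types (U : set 'rV[R]_d.+1) (f g : 'rV[R]_d.+1 -> R).

Lemma Ck_ext k U f g : open U -> (forall x, U x -> f x = g x) ->
  Ck k U f -> Ck k U g.
Proof.
move=> oU; have nearU f1 g1 : (forall x, U x -> f1 x = g1 x) ->
    forall x, U x -> {near x, f1 =1 g1}.
  move=> fg x Ux; near=> y; apply: fg.
  by near: y; exact: (open_nbhs_nbhs (conj oU Ux)).
have cont f1 g1 : (forall x, U x -> f1 x = g1 x) ->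
    (forall x, U x -> {for x, continuous f1}) ->
    forall x, U x -> {for x, continuous g1}.
  move=> fg cf x Ux; rewrite /prop_for /continuous_at -(fg _ Ux).
  apply: cvg_trans (cf x Ux); apply: (@near_eq_cvg _ _ (nbhs x)).
  exact: (nearU _ _ fg x Ux).
elim: k f g => [|k IH] f g fg [cf Df]; split=> //; try exact: cont fg cf.
move=> i; have [dfi Cfi] := Df i; split.
  by move=> x Ux; apply: near_eq_derivable (nearU _ _ fg x Ux) (dfi x Ux).
by apply: IH Cfi => x Ux; exact: near_eq_derive (nearU _ _ fg x Ux).
Unshelve. all: by end_near. Qed.

Lemma Ck_pred k U f : Ck k.+1 U f -> Ck k U f.
Proof.
elim: k f => [|k IH] f [cf Df]; first by split.
by split=> // i; have [dfi Cfi] := Df i; split=> //; exact: IH.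
Qed.

Lemma Ck_cst k U (a : R) : open U -> Ck k U (cst a).
Proof.
move=> oU; elim: k a => [|k IH] a; split=> //.
- by move=> x _; exact: cst_continuous.
- by move=> x _; exact: cst_continuous.
- move=> i; split; first by move=> x _; exact: derivable_cst.
  by apply: (@Ck_ext _ _ (cst 0)) => // x _; rewrite derive_cst.
Qed.

Lemma CkD k U f g : open U -> Ck k U f -> Ck k U g -> Ck k U (f + g).
Proof.
move=> oU; elim: k f g => [|k IH] f g [cf Df] [cg Dg].
  by split=> // x Ux; apply: continuousD; [exact: cf|exact: cg].
split; first by move=> x Ux; apply: continuousD; [exact: cf|exact: cg].
move=> i; have [dfi Cfi] := Df i; have [dgi Cgi] := Dg i; split.
  by move=> x Ux; apply: derivableD; [exact: dfi|exact: dgi].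
apply: Ck_ext (IH _ _ Cfi Cgi) => // x Ux.
by rewrite deriveD //; [exact: dfi|exact: dgi].
Qed.

Lemma CkM k U f g : open U -> Ck k U f -> Ck k U g -> Ck k U (f * g).
Proof.
move=> oU; elim: k f g => [|k IH] f g Cf Cg.
  by split=> // x Ux; apply: continuousM; [exact: Cf.1|exact: Cg.1].
split; first by move=> x Ux; apply: continuousM; [exact: Cf.1|exact: Cg.1].
move=> i; have [dfi Cfi] := Cf.2 i; have [dgi Cgi] := Cg.2 i; split.
  by move=> x Ux; apply: derivableM; [exact: dfi|exact: dgi].
apply: Ck_ext (CkD oU (IH _ _ (Ck_pred Cf) Cgi) (IH _ _ (Ck_pred Cg) Cfi)) => //.
by move=> x Ux; rewrite deriveM //; [exact: dfi|exact: dgi].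
Qed.

End EuclideanSmooth.

(** * Smooth manifolds *)

Record chart (R : realType) (d : nat) (T : topologicalType) := Chart {
  chart_dom : set T;
  chart_map : T -> 'rV[R]_d.+1;
  chart_inv : 'rV[R]_d.+1 -> T;
  chart_dom_open : open chart_dom;
  chart_cod_open : open (chart_map @` chart_dom);
  chart_mapK : forall x, chart_dom x -> chart_inv (chart_map x) = x;
  chart_map_cont : {within chart_dom, continuous chart_map};
  chart_inv_cont : {within chart_map @` chart_dom, continuous chart_inv} }.

Arguments chart_dom_open {R d T} c.
Arguments chart_cod_open {R d T} c.

(* Connected smooth manifolds of dimension d.+1; the atlas is not required to
   be maximal. *)
Record manifold (R : realType) (d : nat) := Manifold {
  carrier :> topologicalType;
  manifold_hausdorff : hausdorff_space carrier;
  manifold_second_countable : @second_countable carrier;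
  manifold_connected : connected [set: carrier];
  atlas : set (chart R d carrier);
  atlas_cover : forall p : carrier, exists2 c, atlas c & chart_dom c p;
  atlas_compat : forall c c', atlas c -> atlas c' -> forall i : 'I_d.+1,
    smooth_on (chart_map c @` (chart_dom c `&` chart_dom c'))
      (fun x => chart_map c' (chart_inv c x) ord0 i) }.

Arguments atlas {R d} m.

Definition smooth (R : realType) (d : nat) (M : manifold R d) : {pred M -> R} :=
  mem [set f : M -> R | forall c, atlas M c ->
         smooth_on (chart_map c @` chart_dom c) (f \o chart_inv c)].

Arguments smooth {R d} M.

Section SmoothFunctions.
Context {R : realType} {d : nat} (M : manifold R d).

Let smoothP (f : M -> R) : f \in smooth M <->
  forall c, atlas M c -> smooth_on (chart_map c @` chart_dom c) (f \o chart_inv c).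
Proof. by rewrite inE. Qed.

Lemma smooth_cst (a : R) : cst a \in smooth M.
Proof. by apply/smoothP => c _ k; apply/Ck_cst/chart_cod_open. Qed.

Lemma smoothD : {in smooth M &, forall f g, f + g \in smooth M}.
Proof.
move=> f g /smoothP sf /smoothP sg; apply/smoothP => c Ac k.
exact: CkD (chart_cod_open c) (sf c Ac k) (sg c Ac k).
Qed.

Lemma smoothM : {in smooth M &, forall f g, f * g \in smooth M}.
Proof.
move=> f g /smoothP sf /smoothP sg; apply/smoothP => c Ac k.
exact: CkM (chart_cod_open c) (sf c Ac k) (sg c Ac k).
Qed.

Fact smooth_subring_closed : subring_closed (smooth M).
Proof.
split; [exact: (smooth_cst 1)| |exact: smoothM].
move=> f g sf sg; have -> : f - g = f + cst (-1) * g.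
  by apply/funext => x; rewrite /= !fctE mulN1r.
by apply: smoothD => //; apply: smoothM => //; exact: smooth_cst.
Qed.

Fact smooth_submod_closed : submod_closed (smooth M).
Proof.
split; first exact: (smooth_cst 0).
move=> a f g sf sg; have -> : a *: f + g = cst a * f + g by [].
by apply: smoothD => //; apply: smoothM => //; exact: smooth_cst.
Qed.

HB.instance Definition _ :=
  GRing.isSubringClosed.Build (M -> R) (smooth M) smooth_subring_closed.
HB.instance Definition _ :=
  GRing.isSubmodClosed.Build R (M -> R) (smooth M) smooth_submod_closed.

(* The ring (and R-vector space) of smooth functions on M. *)
Definition Cinf : Type := {f : M -> R | f \in smooth M}.
HB.instance Definition _ := SubChoice.on Cinf.
HB.instance Definition _ :=
  GRing.SubChoice_isSubComPzRing.Build (M -> R) (smooth M) Cinf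
    smooth_subring_closed.
HB.instance Definition _ := [SubZmodule_isSubLmodule of Cinf by <:].
Definition Cinf_fun (f : Cinf) : M -> R := val f.

End SmoothFunctions.
Arguments Cinf {R d} M.
Coercion Cinf_fun : Cinf >-> Funclass.

(** * Vector fields, tensors and connections *)

(* A smooth vector field is a family (V_p) of derivations at the points p of M
   such that p |-> V_p f is smooth for all f in C^oo(M), i.e. a derivation
   f |-> (p |-> V_p f) of the R-algebra C^oo(M).  The regular module [^o] makes
   such maps a module over C^oo(M). *)
Definition derivation (R : realType) (d : nat) (M : manifold R d) :
    {pred Cinf M -> (Cinf M)^o} :=
  mem [set V : Cinf M -> Cinf M |
    (forall (a : R) (f g : Cinf M), V (a *: f + g) = a *: V f + V g) /\
    (forall f g : Cinf M, V (f * g) = V f * g + f * V g)].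
Arguments derivation {R d} M.

Section VectorFields.
Context {R : realType} {d : nat} (M : manifold R d).

Let derivationP (V : Cinf M -> Cinf M) : V \in derivation M <->
  (forall (a : R) (f g : Cinf M), V (a *: f + g) = a *: V f + V g) /\
  (forall f g : Cinf M, V (f * g) = V f * g + f * V g).
Proof. by rewrite inE. Qed.

Let scaleAl (a : R) (f g : Cinf M) : a *: (f * g) = (a *: f) * g.
Proof. by apply/val_inj/funext => x; exact: mulrA. Qed.

Let scaleAr (a : R) (f g : Cinf M) : a *: (f * g) = f * (a *: g).
Proof. by rewrite mulrC scaleAl mulrC. Qed.

Fact derivation_submod_closed : submod_closed (derivation M).
Proof.
split.
  have E f : (0 : Cinf M -> (Cinf M)^o) f = 0 by [].
  apply/derivationP; split=> [a f g|f g]; rewrite !E.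
    by rewrite scaler0 addr0.
  by rewrite mul0r mulr0 addr0.
move=> h V W /derivationP[Vlin Vleib] /derivationP[Wlin Wleib].
have E f : (h *: V + W) f = h * V f + W f by [].
apply/derivationP; split=> [a f g|f g]; rewrite !E.
  by rewrite Vlin Wlin scalerDr scaleAr mulrDr addrACA.
by rewrite Vleib Wleib !(mulrDr, mulrDl) !mulrA (mulrC f h) addrACA.
Qed.

HB.instance Definition _ := GRing.isSubmodClosed.Build (Cinf M)
  (Cinf M -> (Cinf M)^o) (derivation M) derivation_submod_closed.

(* The C^oo(M)-module of vector fields. *)
Definition vfield : Type := {V : Cinf M -> (Cinf M)^o | V \in derivation M}.
HB.instance Definition _ := SubChoice.on vfield.
HB.instance Definition _ := [SubChoice_isSubLmodule of vfield by <:].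
Definition vfield_fun (V : vfield) : Cinf M -> Cinf M := val V.

Fact lie_subproof (V W : vfield) :
  (fun f => vfield_fun V (vfield_fun W f) - vfield_fun W (vfield_fun V f))
    \in derivation M.
Proof.
case: V W => [V dV] [W dW]; rewrite /vfield_fun /=.
move/derivationP: dV => [Vlin Vleib]; move/derivationP: dW => [Wlin Wleib].
have VD f g : V (f + g) = V f + V g by have := Vlin 1 f g; rewrite !scale1r.
have WD f g : W (f + g) = W f + W g by have := Wlin 1 f g; rewrite !scale1r.
apply/derivationP; split=> [a f g|f g].
  by rewrite Vlin Wlin Vlin Wlin scalerBr opprD addrACA.
rewrite Vleib Wleib VD WD !Vleib !Wleib.
move: (V f) (V g) (W f) (W g) (V (W f)) (V (W g)) (W (V f)) (W (V g)).
by move=> Vf Vg Wf Wg VWf VWg WVf WVg; ring.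
Qed.

Definition lie (V W : vfield) : vfield :=
  exist (fun U => U \in derivation M) _ (lie_subproof V W).

End VectorFields.
Arguments vfield {R d} M.
Coercion vfield_fun : vfield >-> Funclass.

(* The value V_p, as a derivation of C^oo(M) at p. *)
Definition tangent (R : realType) (d : nat) (M : manifold R d) (V : vfield M)
  (p : M) : Cinf M -> R := fun f => V f p.

(* 1-forms and (1,1)-tensors are taken as the C^oo(M)-linear maps
   [{scalar vfield M}] and [{linear vfield M -> vfield M}]. *)

Record metric (R : realType) (d : nat) (M : manifold R d) := Metric {
  metric_form :> vfield M -> {scalar vfield M};
  metric_sym : forall V W, metric_form V W = metric_form W V;
  metric_ge0 : forall V p, 0 <= (metric_form V V : Cinf M) p;
  metric_eq0 : forall V p, (metric_form V V : Cinf M) p = 0 <-> tangent V p = 0 }.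

Section Geometry.
Context {R : realType} {d : nat} {M : manifold R d}.
Implicit Types (V W Z X Y : vfield M) (eta : {scalar vfield M}) (g : metric M)
  (phi : {linear vfield M -> vfield M}) (nabla : vfield M -> vfield M -> vfield M).

(* Exterior derivative, with the convention
   2 d eta(V, W) = V (eta W) - W (eta V) - eta [V, W]. *)
Definition dform eta V W : Cinf M :=
  (2^-1 : R) *: (V (eta W) - W (eta V) - eta (lie V W)).

(* (eta /\ (d eta)^n)(V_0, ..., V_2n), up to a nonzero constant factor. *)
Definition wedge_dform n eta (V : 'I_(n.*2.+1) -> vfield M) : Cinf M :=
  \sum_(s : 'S_(n.*2.+1))
    (-1) ^+ s * (eta (V (s ord0)) *
      \prod_(i < n) dform eta (V (s (inord i.*2.+1))) (V (s (inord i.*2.+2)))).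

Definition connection nabla : Prop :=
  [/\ forall V V' W, nabla (V + V') W = nabla V W + nabla V' W,
      forall (f : Cinf M) V W, nabla (f *: V) W = f *: nabla V W,
      forall V W W', nabla V (W + W') = nabla V W + nabla V W' &
      forall (f : Cinf M) V W, nabla V (f *: W) = V f *: W + f *: nabla V W].

Definition metric_connection g nabla : Prop :=
  forall V W Z, V (g W Z) = g (nabla V W) Z + g W (nabla V Z).

Definition levi_civita g nabla : Prop :=
  [/\ connection nabla, metric_connection g nabla &
      forall V W, nabla V W - nabla W V = lie V W].

(* A distribution assigns to p a set of derivations at p. *)
Definition tangent_distribution : Type := M -> set (Cinf M -> R).

Implicit Types L Q : tangent_distribution.

Definition section_of L V : Prop := forall p, L p (tangent V p).

(* Rank k subbundles of TM.  The local frames are restrictions of global vector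
   fields: on a smaller neighborhood this is no restriction. *)
Definition subbundle (k : nat) L : Prop :=
  forall p : M, exists2 U : set M, nbhs p U &
    exists X : 'I_k -> vfield M, forall q, U q ->
      (forall c : 'I_k -> R,
         \sum_i c i *: tangent (X i) q = 0 -> forall i, c i = 0) /\
      L q = [set v | exists c : 'I_k -> R, v = \sum_i c i *: tangent (X i) q].

Definition legendrian (n : nat) eta L : Prop :=
  [/\ subbundle n L,
      forall V p, L p (tangent V p) -> (eta V : Cinf M) p = 0 &
      forall X X', section_of L X -> section_of L X' -> dform eta X X' = 0].

Definition flat_distribution (xi : vfield M) L : Prop :=
  forall X, section_of L X -> section_of L (lie xi X).

(* Integrability is taken at the level of sections, i.e. as involutivity. *)
Definition integrable_distribution L : Prop :=
  forall X X', section_of L X -> section_of L X' -> section_of L (lie X X').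

(* The image distribution phi L. *)
Definition image_distribution phi L : tangent_distribution :=
  fun p => [set v | exists2 V, L p (tangent V p) & v = tangent (phi V) p].

(* TM is the direct sum of L1, L2 and R xi, with projections p1, p2 and p0. *)
Definition projections L1 L2 (xi : vfield M)
    (p1 p2 p0 : vfield M -> vfield M) : Prop :=
  (forall V, [/\ section_of L1 (p1 V), section_of L2 (p2 V),
       exists f : Cinf M, p0 V = f *: xi & V = p1 V + p2 V + p0 V]) /\
  (forall X Y (f : Cinf M), section_of L1 X -> section_of L2 Y ->
     X + Y + f *: xi = 0 -> [/\ X = 0, Y = 0 & f *: xi = 0]).

(* nabla is the bi-Legendrian connection of the transversal pair (L1, L2) of
   Legendrian distributions of the contact form eta with Reeb field xi.  The
   projections and H are uniquely determined. *)
Definition bi_legendrian_connection eta (xi : vfield M) L1 L2 nabla : Prop :=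
  connection nabla /\
  exists (p1 p2 p0 : vfield M -> vfield M)
         (H : vfield M -> vfield M -> vfield M),
  [/\ projections L1 L2 xi p1 p2 p0,
      forall V W, eta (H V W) = 0 /\
        forall Z, eta Z = 0 ->
          dform eta (H V W) Z = V (dform eta W Z) - dform eta W (lie V Z),
      forall W X, section_of L1 X ->
        nabla W X = p1 (H (p1 W) X) + p1 (lie (p2 W) X) + p1 (lie (p0 W) X),
      forall W Y, section_of L2 Y ->
        nabla W Y = p2 (H (p2 W) Y) + p2 (lie (p1 W) Y) + p2 (lie (p0 W) Y) &
      forall W (f : Cinf M), nabla W (f *: xi) = W f *: xi].

End Geometry.
Arguments tangent_distribution {R d} M.

(** * Contact metric structures *)

Record contact_metric (R : realType) (n : nat) (M : manifold R n.*2) :=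
  ContactMetric {
    cm_phi : {linear vfield M -> vfield M};
    cm_xi : vfield M;
    cm_eta : {scalar vfield M};
    cm_g : metric M;
    cm_contact : forall p : M, exists V : 'I_(n.*2.+1) -> vfield M,
      wedge_dform cm_eta V p != 0;
    cm_eta_xi : cm_eta cm_xi = 1;
    cm_reeb : forall V, dform cm_eta cm_xi V = 0;
    cm_g_xi : forall V, cm_g V cm_xi = cm_eta V;
    cm_phi2 : forall V, cm_phi (cm_phi V) = - V + cm_eta V *: cm_xi;
    cm_dform : forall V W, dform cm_eta V W = cm_g V (cm_phi W) }.

Section ContactMetric.
Context {R : realType} {n : nat} {M : manifold R n.*2} (S : contact_metric M).
Implicit Types (V W : vfield M).
Local Notation phi := (cm_phi S).
Local Notation xi := (cm_xi S).
Local Notation eta := (cm_eta S).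

(* h is half the Lie derivative of phi along xi. *)
Definition cm_h V : vfield M :=
  ((2^-1 : R) *: (1 : Cinf M)) *: (lie xi (phi V) - phi (lie xi V)).

(* [D] stands for the Levi-Civita connection of the metric. *)
Definition tanaka_webster (D : vfield M -> vfield M -> vfield M) V W :
    vfield M :=
  D V W + eta V *: phi W + eta W *: (phi V + phi (cm_h V))
    + dform eta (V + cm_h V) W *: xi.

(* [phi, phi] + 2 d eta (x) xi = 0, with [phi, phi] the Nijenhuis torsion. *)
Definition sasakian : Prop := forall V W,
  phi (phi (lie V W)) + lie (phi V) (phi W) - phi (lie (phi V) W)
    - phi (lie V (phi W)) + (2 * dform eta V W) *: xi = 0.

End ContactMetric.

(* Main.v *)
From mathcomp Require Import all_boot all_order all_algebra all_reals.
From mathcomp Require Import all_classical topology ring.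
Require Import Defs.

Set Implicit Arguments.
Unset Strict Implicit.
Unset Printing Implicit Defensive.

Import Order.TTheory GRing.Theory Num.Theory.
Local Open Scope ring_scope.

(** Write [E] for the tensor measuring how far the torsion of the bi-Legendrian
    connection [nabla] is from [2 d eta (x) xi].  Everything rests on three
    facts.

    - [nabla] parallelizes [d eta] ([bi_legendrian_dform]), because
      [d (d eta) = 0].  Since [d eta = g (_, phi _)] and [nabla] is
      metric, it parallelizes [phi] too ([bi_legendrian_phi]).
    - Flatness says that [nabla_xi V = [xi, V]] ([bi_legendrian_xi_lie]), so
      [L_xi phi = nabla_xi phi = 0], that is [h = 0].  The Tanaka-Webster
      connection then loses its [h] terms and becomes a metric connection
      with torsion [2 d eta (x) xi] ([tanaka_webster_metric],
      [tanaka_webster_torsion]).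
    - A metric connection is determined by its torsion
      ([metric_connection_unique]).

    So [nabla] is the Tanaka-Webster connection iff [E = 0].  On a section of
    [L] and one of [Q], and whenever one argument is [xi], [E] always vanishes.
    On two sections [X], [X'] of [L] it is
    [nabla_X X' - nabla_X' X - [X, X']], where [nabla] preserves [L].  If
    [E = 0] then [[X, X']] lies in [L].  Conversely, if [L] is integrable then
    this vector lies in [L] and closedness of [d eta] shows that it pairs to
    zero with [Q] under [d eta]; as [d eta] pairs [L] and [Q = phi L]
    perfectly, it is zero ([bi_legendrian_torsion_integrable]).  The same
    holds for [Q].  Finally, when [phi] is parallel the Nijenhuis tensor only
    involves the torsion, and torsion [2 d eta (x) xi] makes it equal to
    [- 2 d eta (x) xi], which is the Sasakian condition
    ([parallel_phi_sasakian]). *)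

(** * Vector fields as derivations *)

Section VectorFieldAlgebra.
Context {R : realType} {d : nat} {M : manifold R d}.
Implicit Types (U V W Z : vfield M) (f h : Cinf M) (p : M).

Lemma vfieldP V W : (forall f, V f = W f) -> V = W.
Proof. by move=> VW; apply/val_inj/funext. Qed.

Lemma vfieldDE V W f : vfield_fun (V + W) f = V f + W f. Proof. by []. Qed.
Lemma vfieldNE V f : vfield_fun (- V) f = - V f. Proof. by []. Qed.
Lemma vfieldZE h V f : vfield_fun (h *: V) f = h * V f. Proof. by []. Qed.
Lemma vfield0E f : vfield_fun (0 : vfield M) f = 0. Proof. by []. Qed.
Lemma lieE V W f : lie V W f = V (W f) - W (V f). Proof. by []. Qed.
Definition vfieldE := (vfieldDE, vfieldNE, vfieldZE, vfield0E, lieE).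

Lemma vfield_lin V (a : R) f h : V (a *: f + h) = a *: V f + V h.
Proof. by have := valP V; rewrite inE => -[+ _]; exact. Qed.

Lemma vfieldM V f h : V (f * h) = V f * h + f * V h.
Proof. by have := valP V; rewrite inE => -[_ +]; exact. Qed.

Lemma vfieldD V f h : V (f + h) = V f + V h.
Proof. by have := vfield_lin V 1 f h; rewrite !scale1r. Qed.

Lemma vfield0 V : V 0 = 0.
Proof. by apply: (addrI (V 0)); rewrite -vfieldD !addr0. Qed.

Lemma vfieldN V f : V (- f) = - V f.
Proof. by apply/eqP; rewrite -subr_eq0 opprK -vfieldD addNr vfield0. Qed.

Lemma vfieldZ V (a : R) f : V (a *: f) = a *: V f.
Proof. by rewrite -[a *: f]addr0 vfield_lin vfield0 addr0. Qed.

Lemma vfield1 V : V 1 = 0.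
Proof.
by have := vfieldM V 1 1; rewrite !mulr1 mul1r -[LHS]addr0 => /addrI.
Qed.

Lemma lieC V W : lie V W = - lie W V.
Proof. by apply: vfieldP => f; rewrite !vfieldE; ring. Qed.

Lemma lieDl V V' W : lie (V + V') W = lie V W + lie V' W.
Proof. by apply: vfieldP => f; rewrite !vfieldE vfieldD; ring. Qed.

Lemma lieZl f V W : lie (f *: V) W = f *: lie V W - W f *: V.
Proof. by apply: vfieldP => h; rewrite !vfieldE vfieldM; ring. Qed.

Lemma lie_jacobi U V W :
  lie U (lie V W) + lie V (lie W U) + lie W (lie U V) = 0.
Proof. by apply: vfieldP => f; rewrite !(vfieldE, vfieldD, vfieldN); ring. Qed.

Definition torsion (nabla : vfield M -> vfield M -> vfield M) V W : vfield M :=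
  nabla V W - nabla W V - lie V W.

Lemma tangentD V W p : tangent (V + W) p = tangent V p + tangent W p.
Proof. by []. Qed.

Lemma tangentN V p : tangent (- V) p = - tangent V p.
Proof. by []. Qed.

Lemma tangent_inj V W : (forall p, tangent V p = tangent W p) -> V = W.
Proof.
move=> VW; apply: vfieldP => f; apply/val_inj/funext => p.
exact: (congr1 (@^~ f) (VW p)).
Qed.

End VectorFieldAlgebra.

Section ExteriorDerivative.
Context {R : realType} {d : nat} {M : manifold R d}.
Implicit Types (U V W : vfield M) (eta : {scalar vfield M}).

Lemma mul2_dform eta V W :
  2 * dform eta V W = V (eta W) - W (eta V) - eta (lie V W).
Proof.
have two_scale (f : Cinf M) : 2 * f = (2 : R) *: f.
  by rewrite mulr_natl scaler_nat.
by rewrite two_scale scalerA mulfV ?scale1r // pnatr_eq0.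
Qed.

(** This is [d (d eta) = 0] up to a factor.  Besides the Jacobi identity, only
    second derivatives of the values of [eta] occur; they cancel in pairs. *)
Lemma dform_closed eta U V W :
  U (dform eta V W) + V (dform eta W U) + W (dform eta U V)
  - dform eta (lie U V) W - dform eta (lie V W) U - dform eta (lie W U) V = 0.
Proof.
rewrite /dform !vfieldZ -!scalerDr -!scalerBr.
have jac : eta (lie U (lie V W)) + eta (lie V (lie W U))
           + eta (lie W (lie U V)) = 0 by rewrite -!raddfD lie_jacobi raddf0.
have etaN X : eta (- X) = - eta X by rewrite linearN.
rewrite (lieC (lie U V)) (lieC (lie V W)) (lieC (lie W U)) !etaN.
rewrite !(vfieldD, vfieldN) !lieE.
set a := (X in _ *: X); suff -> : a = 0 by rewrite scaler0.
rewrite {}/a -[RHS]oppr0 -jac; ring.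
Qed.

End ExteriorDerivative.

(** * Metrics and metric connections *)

Section Metric.
Context {R : realType} {d : nat} {M : manifold R d} (g : metric M).
Implicit Types (V W Z : vfield M) (f : Cinf M).
Implicit Types nabla : vfield M -> vfield M -> vfield M.

Lemma metricDl V V' W : g (V + V') W = g V W + g V' W.
Proof. by rewrite !(metric_sym _ _ W) linearD. Qed.

Lemma metricNl V W : g (- V) W = - g V W.
Proof. by rewrite !(metric_sym _ _ W) linearN. Qed.

Lemma metricZl f V W : g (f *: V) W = f * g V W.
Proof. by rewrite !(metric_sym _ _ W) linearZ. Qed.

Lemma metricDr V W W' : g V (W + W') = g V W + g V W'.
Proof. by rewrite linearD. Qed.

Lemma metricNr V W : g V (- W) = - g V W.
Proof. by rewrite linearN. Qed.

Lemma metricZr f V W : g V (f *: W) = f * g V W.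
Proof. by rewrite linearZ. Qed.

Definition metricE :=
  (metricDl, metricNl, metricZl, metricDr, metricNr, metricZr).

Lemma metric_eq0_vfield V : g V V = 0 -> V = 0.
Proof.
move=> gV0; apply: tangent_inj => p; apply/(metric_eq0 g V p).
by rewrite gV0.
Qed.

Lemma metric_nondegenerate V : (forall Z, g V Z = 0) -> V = 0.
Proof. by move=> gV0; apply: metric_eq0_vfield. Qed.

Lemma Cinf_double_inj f f' : f + f = f' + f' -> f = f'.
Proof.
move=> ff'; apply: (@scalerI _ _ (2 : R)); first by rewrite pnatr_eq0.
by rewrite !scaler_nat !mulr2n.
Qed.

(** The difference [B] of the two connections is symmetric because the
    torsions agree, and each [B V] is skew because both are metric.  Then the
    expression [g (B V W) Z] is symmetric in [V], [W] and skew in [W],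
    [Z]; moving through the six orderings of its arguments shows that it is
    its own opposite. *)
Lemma metric_connection_unique nabla nabla' :
  metric_connection g nabla -> metric_connection g nabla' ->
  (forall V W, torsion nabla V W = torsion nabla' V W) ->
  forall V W, nabla V W = nabla' V W.
Proof.
move=> mN mN' eqT.
pose B V W := nabla V W - nabla' V W.
have symB V W : B V W = B W V.
  apply/eqP; rewrite -subr_eq0; apply/eqP.
  have /eqP := eqT V W; rewrite -subr_eq0 => /eqP <-.
  by apply: vfieldP => f; rewrite !vfieldE; ring.
have skewB V W Z : g (B V W) Z = - g W (B V Z).
  have /eqP := mN V W Z; rewrite mN' -subr_eq0 => /eqP E.
  apply/eqP; rewrite -subr_eq0 opprK; apply/eqP.
  by rewrite -[RHS]oppr0 -E /B !metricE; ring.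
move=> V W; apply/eqP; rewrite -subr_eq0; apply/eqP.
apply: metric_nondegenerate => Z; rewrite -/(B V W).
apply: Cinf_double_inj; rewrite addr0.
have E : g (B V W) Z = - g (B V W) Z.
  rewrite {1}skewB symB metric_sym skewB opprK metric_sym symB skewB metric_sym.
  by rewrite symB.
by rewrite {1}E addNr.
Qed.

End Metric.

(** * Contact metric structures *)

Section ContactMetric.
Context {R : realType} {n : nat} {M : manifold R n.*2} (S : contact_metric M).
Implicit Types (U V W X Y Z : vfield M) (f : Cinf M) (p : M).
Local Notation phi := (cm_phi S).
Local Notation xi := (cm_xi S).
Local Notation eta := (cm_eta S).
Local Notation g := (cm_g S).
Local Notation deta := (dform (cm_eta S)).

Lemma dformC V W : deta V W = - deta W V.
Proof. by rewrite /dform -scalerN (lieC V W) linearN; congr (_ *: _); ring. Qed.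

Lemma dformDl V V' W : deta (V + V') W = deta V W + deta V' W.
Proof. by rewrite !cm_dform metricDl. Qed.

Lemma dformNl V W : deta (- V) W = - deta V W.
Proof. by rewrite !cm_dform metricNl. Qed.

Lemma dformZl f V W : deta (f *: V) W = f * deta V W.
Proof. by rewrite !cm_dform metricZl. Qed.

Lemma dformDr V W W' : deta V (W + W') = deta V W + deta V W'.
Proof. by rewrite !cm_dform linearD metricDr. Qed.

Lemma dformNr V W : deta V (- W) = - deta V W.
Proof. by rewrite !cm_dform linearN metricNr. Qed.

Lemma dformZr f V W : deta V (f *: W) = f * deta V W.
Proof. by rewrite !cm_dform linearZ metricZr. Qed.

Lemma dform_xir V : deta V xi = 0.
Proof. by rewrite dformC cm_reeb oppr0. Qed.

Definition dformE :=
  (dformDl, dformNl, dformZl, dformDr, dformNr, dformZr, cm_reeb, dform_xir).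

Lemma eta_scale_xi f : eta (f *: xi) = f.
Proof. by rewrite linearZ cm_eta_xi; apply: mulr1. Qed.

Lemma eta_lie V W : eta (lie V W) = V (eta W) - W (eta V) - 2 * deta V W.
Proof. by rewrite mul2_dform; ring. Qed.

Lemma phi_xi : phi xi = 0.
Proof.
apply: (@metric_nondegenerate _ _ _ g) => Z; rewrite metric_sym -cm_dform.
exact: dform_xir.
Qed.

Lemma eta_phi V : eta (phi V) = 0.
Proof. by rewrite -cm_g_xi metric_sym -cm_dform cm_reeb. Qed.

Lemma metric_phi_skew V W : g (phi V) W = - g V (phi W).
Proof. by rewrite metric_sym -!cm_dform dformC. Qed.

Lemma metric_phi2 V W : g (phi V) (phi W) = g V W - eta V * eta W.
Proof.
by rewrite metric_phi_skew cm_phi2 !metricE cm_g_xi; ring.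
Qed.

Lemma dform_phi2 V W : deta (phi V) (phi W) = deta V W.
Proof. by rewrite !cm_dform metric_phi2 !eta_phi mulr0 subr0. Qed.

(** A (1,1)-tensor acts pointwise.  For [eta] and [phi] this needs no bump
    function: [|phi V|^2 = |V|^2 - eta(V)^2] and [|phi V|^2 >= 0] at [p], so
    [eta V] and [phi V] vanish where [V] does. *)
Lemma tangent0_eta_phi V p :
  tangent V p = 0 -> (eta V : Cinf M) p = 0 /\ tangent (phi V) p = 0.
Proof.
move=> /(metric_eq0 g) gV0.
have gphi : (g (phi V) (phi V) : Cinf M) p = - (eta V : Cinf M) p ^+ 2.
  rewrite metric_phi2 -[LHS]/((g V V : Cinf M) p - (eta V : Cinf M) p ^+ 2).
  by rewrite gV0 sub0r.
have etaV0 : (eta V : Cinf M) p = 0.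
  have := metric_ge0 g (phi V) p; rewrite gphi oppr_ge0 => le0.
  by apply/eqP; rewrite -sqrf_eq0 eq_le le0 sqr_ge0.
by split=> //; apply/(metric_eq0 g); rewrite gphi etaV0 expr0n oppr0.
Qed.

Lemma tangent_phi V W p : tangent V p = tangent W p ->
  (eta V : Cinf M) p = (eta W : Cinf M) p /\
  tangent (phi V) p = tangent (phi W) p.
Proof.
move=> VW; have [|e t] := @tangent0_eta_phi (V - W) p.
  by rewrite tangentD tangentN VW subrr.
split; apply/eqP; rewrite -subr_eq0.
  by apply/eqP; rewrite -e linearB.
by rewrite -tangentN -tangentD -linearB t.
Qed.

End ContactMetric.

(** * Conjugate Legendrian distributions *)

Section Conjugate.
Context {R : realType} {n : nat} {M : manifold R n.*2} (S : contact_metric M).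
Implicit Types (U V W X Y Z : vfield M) (f : Cinf M) (p : M).
Implicit Types (L : tangent_distribution M).
Implicit Types nabla : vfield M -> vfield M -> vfield M.
Local Notation phi := (cm_phi S).
Local Notation xi := (cm_xi S).
Local Notation eta := (cm_eta S).
Local Notation g := (cm_g S).
Local Notation deta := (dform (cm_eta S)).

Lemma dform_phi_eq0 V : eta V = 0 -> deta V (phi V) = 0 -> V = 0.
Proof.
move=> etaV; rewrite cm_dform cm_phi2 etaV scale0r addr0 linearN => /eqP.
by rewrite oppr_eq0 => /eqP; exact: metric_eq0_vfield.
Qed.

(** What the argument uses of a Legendrian distribution [L1] and the conjugate
    one [L2], at the level of sections.  Conjugate Legendrian distributions
    satisfy this in both orders, so every statement about [L1] below also
    gives the one about [L2]. *)
Record legendrian_into L1 L2 : Prop := LegendrianInto {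
  lsec0 : section_of L1 0;
  lsecB : forall X X', section_of L1 X -> section_of L1 X' ->
    section_of L1 (X - X');
  lsec_eta : forall X, section_of L1 X -> eta X = 0;
  lsec_dform : forall X X', section_of L1 X -> section_of L1 X' ->
    deta X X' = 0;
  lsec_phi : forall X, section_of L1 X -> section_of L2 (phi X) }.

Lemma subbundle_sub k L p (u v : Cinf M -> R) :
  subbundle k L -> L p u -> L p v -> L p (u - v).
Proof.
move=> /(_ p)[U /nbhs_singleton Up [X /(_ p Up)[_ ->]]] [c ->] [c' ->].
exists (fun i => c i - c' i); rewrite -sumrB.
by apply: eq_bigr => i _; rewrite scalerBl.
Qed.

Lemma subbundle0 k L p : subbundle k L -> L p 0.
Proof.
move=> /(_ p)[U /nbhs_singleton Up [X /(_ p Up)[_ ->]]].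
by exists (fun=> 0); rewrite big1 // => i _; rewrite scale0r.
Qed.

Lemma legendrian_into_image k L : legendrian k eta L ->
  legendrian_into L (image_distribution phi L).
Proof.
case=> sbL etaL dL; split=> //.
- by move=> p; exact: subbundle0 sbL.
- by move=> X X' LX LX' p; exact: subbundle_sub sbL (LX p) (LX' p).
- by move=> X LX; apply/val_inj/funext => p; exact: etaL (LX p).
- by move=> X LX p; exists X.
Qed.

(** By pointwiseness of [phi] a section [Y] of [phi L] is everywhere of the
    form [phi V] with [V] in [L], so [phi Y] is a section of [L]; then
    [d eta (Y, Y') = d eta (phi Y, phi Y')] gives isotropy. *)
Lemma image_legendrian_into k L : legendrian k eta L ->
  legendrian_into (image_distribution phi L) L.
Proof.
move=> legL; have [sbL etaL dL] := legL.
have key Y : section_of (image_distribution phi L) Y ->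
    eta Y = 0 /\ section_of L (phi Y).
  move=> QY; split; last move=> p.
    apply/val_inj/funext => p; have [V LV YV] := QY p.
    have [etaY _] := tangent_phi S YV.
    by rewrite -[LHS]/((eta Y : Cinf M) p) etaY eta_phi.
  have [V LV YV] := QY p; have [_ ->] := tangent_phi S YV.
  have -> : tangent (phi (phi V)) p = 0 - tangent V p.
    rewrite cm_phi2 tangentD tangentN sub0r.
    have -> : tangent (eta V *: xi) p = 0.
      apply/funext => f; rewrite /tangent vfieldZE.
      by rewrite -[LHS]/((eta V : Cinf M) p * _) (etaL _ _ LV) mul0r.
    by rewrite addr0.
  exact: subbundle_sub sbL (subbundle0 p sbL) LV.
split.
- by move=> p; exists 0; [exact: subbundle0 sbL | rewrite linear0].
- move=> Y Y' QY QY' p; have [V LV YV] := QY p; have [V' LV' YV'] := QY' p.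
  exists (V - V'); first exact: subbundle_sub sbL LV LV'.
  by rewrite linearB !(tangentD, tangentN) YV YV'.
- by move=> Y /key[].
- move=> Y Y' /key[_ LY] /key[_ LY'].
  by rewrite -dform_phi2 dL.
- by move=> Y /key[].
Qed.

Section Pair.
Variables (L1 L2 : tangent_distribution M).
Hypotheses (into12 : legendrian_into L1 L2) (into21 : legendrian_into L2 L1).

Lemma lsecD X X' :
  section_of L1 X -> section_of L1 X' -> section_of L1 (X + X').
Proof.
move=> L1X L1X'; have -> : X + X' = X - (0 - X') by rewrite sub0r opprK.
by do !apply: (lsecB into12) => //; exact: lsec0 into12.
Qed.

(** The test section [phi X] suffices, as [d eta (X, phi X) = - |X|^2]. *)
Lemma legendrian_nondegenerate X : section_of L1 X ->
  (forall Y, section_of L2 Y -> deta X Y = 0) -> X = 0.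
Proof.
move=> L1X dX; apply: dform_phi_eq0; first exact: lsec_eta into12 _ L1X.
exact: dX (lsec_phi into12 L1X).
Qed.

End Pair.

Lemma projections_sym L1 L2 (p1 p2 p0 : vfield M -> vfield M) :
  projections L1 L2 xi p1 p2 p0 -> projections L2 L1 xi p2 p1 p0.
Proof.
move=> [dec uniq]; split.
  by move=> V; have [? ? ? ?] := dec V; split=> //; rewrite (addrC (p2 V)).
move=> X Y f L2X L1Y; rewrite (addrC X) => /(uniq _ _ _ L1Y L2X)[? ? ?].
by split.
Qed.

Lemma bi_legendrian_sym L1 L2 nabla :
  bi_legendrian_connection eta xi L1 L2 nabla ->
  bi_legendrian_connection eta xi L2 L1 nabla.
Proof.
move=> [cn [p1 [p2 [p0 [H [pr HE n1 n2 nx]]]]]]; split=> //.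
by exists p2, p1, p0, H; split=> //; exact: projections_sym.
Qed.

Lemma projections_eq L1 L2 (p1 p2 p0 : vfield M -> vfield M) X Y f :
  legendrian_into L1 L2 -> legendrian_into L2 L1 ->
  projections L1 L2 xi p1 p2 p0 ->
  section_of L1 X -> section_of L2 Y ->
  [/\ p1 (X + Y + f *: xi) = X, p2 (X + Y + f *: xi) = Y &
      p0 (X + Y + f *: xi) = f *: xi].
Proof.
move=> i12 i21 [dec uniq] L1X L2Y; set V := _ + _.
have [L1V L2V [h p0V] VE] := dec V.
have [|||/eqP + /eqP + /eqP] := uniq (p1 V - X) (p2 V - Y) (h - f).
- exact: lsecB i12 _ _ L1V L1X.
- exact: lsecB i21 _ _ L2V L2Y.
- rewrite scalerBl -p0V.
  have : V - V = 0 by rewrite subrr.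
  rewrite {1}VE /V => <-.
  by apply: vfieldP => k; rewrite !vfieldE; ring.
by rewrite scalerBl -p0V !subr_eq0 => /eqP -> /eqP -> /eqP ->.
Qed.

(** * The bi-Legendrian connection *)

Section BiLegendrian.
Variables (L1 L2 : tangent_distribution M).
Variable nabla : vfield M -> vfield M -> vfield M.
Hypotheses (into12 : legendrian_into L1 L2) (into21 : legendrian_into L2 L1).
Hypothesis bl : bi_legendrian_connection eta xi L1 L2 nabla.

Lemma bi_legendrian_decompose V : exists X Y f,
  [/\ section_of L1 X, section_of L2 Y & V = X + Y + f *: xi].
Proof.
have [_ [p1 [p2 [p0 [H [[/(_ V)[L1V L2V [f p0V] VE] _] _ _ _ _]]]]]] := bl.
by exists (p1 V), (p2 V), f; rewrite -p0V.
Qed.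

Lemma bi_legendrian_preserves V X :
  section_of L1 X -> section_of L1 (nabla V X).
Proof.
have [_ [p1 [p2 [p0 [H [[dec _] _ n1 _ _]]]]]] := bl.
move=> L1X; rewrite (n1 _ _ L1X).
have p1L W : section_of L1 (p1 W) by have [] := dec W.
by do !apply: (lsecD into12).
Qed.

Lemma bi_legendrian_xi V : nabla V xi = 0.
Proof.
have [_ [p1 [p2 [p0 [H [_ _ _ _ nx]]]]]] := bl.
by rewrite -[xi]scale1r nx vfield1 scale0r.
Qed.

(** Both [H]-terms are designed to give the derivative of [d eta (X, Y)] along
    the [L1] and [L2] parts of [V], the brackets cancelling.  What is left is
    the part of [V] along [xi], where [L_{f xi} d eta = 0] by closedness and
    [d eta (xi, _) = 0]. *)
Lemma bi_legendrian_dform_cross V X Y : section_of L1 X -> section_of L2 Y ->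
  V (deta X Y) = deta (nabla V X) Y + deta X (nabla V Y).
Proof.
have [_ [p1 [p2 [p0 [H [[dec _] HE n1 n2 _]]]]]] := bl.
move=> L1X L2Y; rewrite (n1 _ _ L1X) (n2 _ _ L2Y) !dformE.
(* Isotropy of [L1] and [L2] makes the projections invisible to [d eta]. *)
have p1E W : deta (p1 W) Y = deta W Y.
  have [L1W L2W [f p0W] WE] := dec W.
  by rewrite [in RHS]WE p0W !dformE (lsec_dform into21 L2W L2Y); ring.
have p2E W : deta X (p2 W) = deta X W.
  have [L1W L2W [f p0W] WE] := dec W.
  by rewrite [in RHS]WE p0W !dformE (lsec_dform into12 L1X L1W); ring.
rewrite !p1E !p2E (dformC _ X (H _ _)).
have [_ ->] := HE (p1 V) X; last exact: lsec_eta into21 _ L2Y.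
have [_ ->] := HE (p2 V) Y; last exact: lsec_eta into12 _ L1X.
have [_ _ [f p0V] VE] := dec V.
have := dform_closed eta (p0 V) X Y.
rewrite (dformC _ _ (p0 V)) {2 3 5}p0V !dformE !(mulr0, oppr0, vfield0).
rewrite (dformC _ Y X) (dformC _ Y (lie _ _)) (lieC Y) !dformE vfieldN.
rewrite (dformC _ (lie (p0 V) Y)) (dformC _ (lie (p2 V) X)).
move=> E; rewrite {1}VE !vfieldE -[RHS]addr0 -E; ring.
Qed.


Lemma bi_legendrian_direct X Y f : section_of L1 X -> section_of L2 Y ->
  X + Y + f *: xi = 0 -> X = 0 /\ Y = 0.
Proof.
have [_ [p1 [p2 [p0 [H [[_ uniq] _ _ _ _]]]]]] := bl.
by move=> L1X L2Y /(uniq _ _ _ L1X L2Y)[].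
Qed.

(** Along [L2] and [xi] the connection is the [L1]-component of the bracket:
    the term in [H] vanishes since [H 0 X = 0] by nondegeneracy of [d eta] on
    the contact distribution. *)
Lemma bi_legendrian_lie V X : section_of L1 X -> section_of L2 V \/ V = xi ->
  exists Y f, section_of L2 Y /\ lie V X = nabla V X + Y + f *: xi.
Proof.
have [_ [p1 [p2 [p0 [H [pr HE n1 _ _]]]]]] := bl.
move=> L1X transV; have [dec _] := pr.
have s10 := lsec0 into12; have s20 := lsec0 into21.
have p1E X' Y f := @projections_eq L1 L2 p1 p2 p0 X' Y f into12 into21 pr.
have p1_0 : p1 0 = 0.
  by have [+ _ _] := p1E 0 0 0 s10 s20; rewrite scale0r !addr0.
have H0 : H 0 X = 0.
  have [etaH dH] := HE 0 X.
  apply: dform_phi_eq0 => //; rewrite dH ?eta_phi //.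
  have -> : lie 0 (phi (H 0 X)) = 0.
    by apply: vfieldP => f; rewrite !vfieldE vfield0 subr0.
  by rewrite vfield0E -[0 : vfield M](scale0r 0) dformZr mul0r subrr.
have -> : nabla V X = p1 (lie V X).
  have lie0 : lie 0 X = 0.
    by apply: vfieldP => f; rewrite !vfieldE vfield0 subr0.
  rewrite (n1 _ _ L1X); case: transV => [L2V | ->].
    have [+ + +] := p1E 0 V 0 s10 L2V; rewrite scale0r addr0 add0r => -> -> ->.
    by rewrite H0 lie0 p1_0 add0r addr0.
  have [+ + +] := p1E 0 0 1 s10 s20; rewrite scale1r addr0 add0r => -> -> ->.
  by rewrite H0 lie0 p1_0 !add0r.
have [_ L2U [f p0U] {1}->] := dec (lie V X).
by exists (p2 (lie V X)), f; rewrite -p0U.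
Qed.

Lemma bi_legendrian_flat X : flat_distribution xi L1 -> section_of L1 X ->
  nabla xi X = lie xi X.
Proof.
move=> flat L1X.
have [Y [f [L2Y E]]] := bi_legendrian_lie L1X (or_intror erefl).
have [||/eqP + _] := @bi_legendrian_direct (nabla xi X - lie xi X) Y f _ L2Y.
- by apply: (lsecB into12) (flat _ L1X); exact: bi_legendrian_preserves.
- by rewrite {1}E; apply: vfieldP => k; rewrite !vfieldE; ring.
by rewrite subr_eq0 => /eqP.
Qed.

End BiLegendrian.

Section BiLegendrianPair.
Variables (L1 L2 : tangent_distribution M).
Variable nabla : vfield M -> vfield M -> vfield M.
Hypotheses (into12 : legendrian_into L1 L2) (into21 : legendrian_into L2 L1).
Hypothesis bl : bi_legendrian_connection eta xi L1 L2 nabla.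

Let lb := bi_legendrian_sym bl.

(** The value of [d eta] on one section of [L1] and one of [L2] is the only
    one that matters: [d eta] vanishes on [L1], on [L2] and on [xi], and
    [nabla] preserves all three. *)
Lemma bi_legendrian_dform V W Z :
  V (deta W Z) = deta (nabla V W) Z + deta W (nabla V Z).
Proof.
have [[_ _ nD nZ] _] := bl.
have [X [Y [f [L1X L2Y ->]]]] := bi_legendrian_decompose bl W.
have [X' [Y' [f' [L1X' L2Y' ->]]]] := bi_legendrian_decompose bl Z.
have s1 := bi_legendrian_preserves into12 bl.
have s2 := bi_legendrian_preserves into21 lb.
have d1 := lsec_dform into12; have d2 := lsec_dform into21.
rewrite !nD !nZ !(bi_legendrian_xi bl) !scaler0 !addr0 !dformE.
rewrite (d1 _ _ L1X L1X') (d2 _ _ L2Y L2Y') (d1 _ _ (s1 V _ L1X) L1X').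
rewrite (d1 _ _ L1X (s1 V _ L1X')) (d2 _ _ (s2 V _ L2Y) L2Y').
rewrite (d2 _ _ L2Y (s2 V _ L2Y')) !(mulr0, addr0, add0r) vfieldD.
rewrite (bi_legendrian_dform_cross into12 into21 bl) //.
rewrite (bi_legendrian_dform_cross into21 into12 lb) //; ring.
Qed.

(** Writing [[X, Y]] and [- [Y, X]] by [bi_legendrian_lie] and comparing
    components gives [[X, Y] = nabla_X Y - nabla_Y X] up to a multiple of
    [xi], whose coefficient is [eta [X, Y] = - 2 d eta (X, Y)]. *)
Lemma bi_legendrian_torsion_cross X Y : section_of L1 X -> section_of L2 Y ->
  torsion nabla X Y = (2 * deta X Y) *: xi.
Proof.
move=> L1X L2Y.
have [Y1 [f [L2Y1 YX]]] :=
  bi_legendrian_lie into12 into21 bl L1X (or_introl L2Y).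
have [X1 [f' [L1X1 XY]]] :=
  bi_legendrian_lie into21 into12 lb L2Y (or_introl L1X).
have L1nX := bi_legendrian_preserves into12 bl Y L1X.
have L2nY := bi_legendrian_preserves into21 lb X L2Y.
have [|||/eqP + _] :=
  @bi_legendrian_direct L1 L2 nabla bl
    (nabla Y X + X1) (nabla X Y + Y1) (f + f').
- exact: (lsecD into12).
- exact: (lsecD into21).
- have /eqP := lieC X Y; rewrite -subr_eq0 opprK XY YX => /eqP <-.
  by apply: vfieldP => k; rewrite !vfieldE; ring.
rewrite addrC addr_eq0 => /eqP X1E.
have f'E : f' = - (2 * deta X Y).
  have := eta_lie S X Y; rewrite XY !linearD /= eta_scale_xi.
  rewrite (lsec_eta into12 L1X) (lsec_eta into21 L2Y) (lsec_eta into12 L1X1).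
  by rewrite (lsec_eta into21 L2nY) !(vfield0, add0r, oppr0).
rewrite /torsion XY X1E f'E.
by apply: vfieldP => k; rewrite !vfieldE; ring.
Qed.

(** Integrability puts the torsion in [L1]; paired with [Y] in [L2] under
    [d eta] it becomes, by parallelism of [d eta], a multiple of
    [d (d eta) (X, X', Y)], hence zero. *)
Lemma bi_legendrian_torsion_integrable X X' : integrable_distribution L1 ->
  section_of L1 X -> section_of L1 X' -> torsion nabla X X' = 0.
Proof.
move=> int L1X L1X'.
have s1 := bi_legendrian_preserves into12 bl.
have L1T : section_of L1 (torsion nabla X X').
  by do !apply: (lsecB into12); [exact: s1 | exact: s1 | exact: int].
apply: (legendrian_nondegenerate into12 L1T) => Y L2Y.
have crossE Z Z' : section_of L1 Z -> section_of L1 Z' ->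
    deta (nabla Z Z') Y = Z (deta Z' Y) - deta Z' (lie Z Y).
  move=> L1Z L1Z'; rewrite (bi_legendrian_dform_cross into12 into21 bl) //.
  have -> : nabla Z Y = lie Z Y + nabla Y Z + (2 * deta Z Y) *: xi.
    rewrite -(bi_legendrian_torsion_cross L1Z L2Y) /torsion.
    by apply: vfieldP => k; rewrite !vfieldE; ring.
  by rewrite !dformE (lsec_dform into12 L1Z' (s1 Y _ L1Z)); ring.
rewrite /torsion !dformE !crossE //.
have := dform_closed eta X X' Y; rewrite (lsec_dform into12 L1X L1X') vfield0.
rewrite (dformC _ Y X) (dformC _ (lie X' Y)) (lieC Y X) !dformE.
rewrite (dformC _ (lie X Y)) !vfieldN => <-; ring.
Qed.

End BiLegendrianPair.

Section FlatPair.
Variables (L1 L2 : tangent_distribution M).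
Variable nabla : vfield M -> vfield M -> vfield M.
Hypotheses (into12 : legendrian_into L1 L2) (into21 : legendrian_into L2 L1).
Hypothesis bl : bi_legendrian_connection eta xi L1 L2 nabla.

Let lb := bi_legendrian_sym bl.

Hypotheses (flat1 : flat_distribution xi L1) (flat2 : flat_distribution xi L2).

Lemma bi_legendrian_xi_lie V : nabla xi V = lie xi V.
Proof.
have [[_ _ nD nZ] _] := bl.
have [X [Y [f [L1X L2Y ->]]]] := bi_legendrian_decompose bl V.
rewrite !nD nZ (bi_legendrian_xi bl) (bi_legendrian_flat into12 into21 bl) //.
rewrite (bi_legendrian_flat into21 into12 lb) //.
by apply: vfieldP => k; rewrite !vfieldE !vfieldD vfieldM; ring.
Qed.

(** The error [E] below is tensorial and skew, so it is enough to test it on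
    sections of [L1], [L2] and on [xi]. *)
Lemma bi_legendrian_torsion V W :
  integrable_distribution L1 -> integrable_distribution L2 ->
  torsion nabla V W = (2 * deta V W) *: xi.
Proof.
move=> int1 int2; have [[nDl nZl nD nZ] _] := bl.
pose E U U' := torsion nabla U U' - (2 * deta U U') *: xi.
have EC U U' : E U U' = - E U' U.
  rewrite /E /torsion (lieC U) (dformC _ U).
  by apply: vfieldP => k; rewrite !vfieldE; ring.
have EDl U U' Z : E (U + U') Z = E U Z + E U' Z.
  rewrite /E /torsion nDl nD lieDl !dformE.
  by apply: vfieldP => k; rewrite !vfieldE; ring.
have EZl f U Z : E (f *: U) Z = f *: E U Z.
  rewrite /E /torsion nZl nZ lieZl !dformE.
  by apply: vfieldP => k; rewrite !vfieldE; ring.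
have EDr Z U U' : E Z (U + U') = E Z U + E Z U'.
  by rewrite !(EC Z) EDl opprD.
have EZr f Z U : E Z (f *: U) = f *: E Z U by rewrite !(EC Z) EZl scalerN.
have Exi U : E xi U = 0.
  rewrite /E /torsion bi_legendrian_xi_lie (bi_legendrian_xi bl) cm_reeb.
  by rewrite mulr0 scale0r !subr0 subrr.
have E11 X X' : section_of L1 X -> section_of L1 X' -> E X X' = 0.
  move=> L1X L1X'.
  rewrite /E (bi_legendrian_torsion_integrable into12 into21 bl) //.
  by rewrite (lsec_dform into12) // mulr0 scale0r subr0.
have E22 Y Y' : section_of L2 Y -> section_of L2 Y' -> E Y Y' = 0.
  move=> L2Y L2Y'.
  rewrite /E (bi_legendrian_torsion_integrable into21 into12 lb) //.
  by rewrite (lsec_dform into21) // mulr0 scale0r subr0.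
have ExiR U : E U xi = 0 by rewrite EC Exi oppr0.
have E12 X Y : section_of L1 X -> section_of L2 Y -> E X Y = 0.
  move=> L1X L2Y.
  by rewrite /E (bi_legendrian_torsion_cross into12 into21 bl) // subrr.
have E21 Y X : section_of L2 Y -> section_of L1 X -> E Y X = 0.
  by move=> L2Y L1X; rewrite EC E12 ?oppr0.
apply/eqP; rewrite -subr_eq0 -/(E V W); apply/eqP.
have [X [Y [f [L1X L2Y ->]]]] := bi_legendrian_decompose bl V.
have [X' [Y' [f' [L1X' L2Y' ->]]]] := bi_legendrian_decompose bl W.
rewrite !(EDl, EDr, EZl, EZr, Exi, ExiR) !scaler0 !addr0.
by rewrite (E12 X Y') // (E21 Y X') // (E11 X X') // (E22 Y Y') // !addr0.
Qed.

Hypothesis metric_nabla : metric_connection g nabla.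

(** [phi] is obtained from [g] and [d eta], both parallel. *)
Lemma bi_legendrian_phi V W : nabla V (phi W) = phi (nabla V W).
Proof.
apply/eqP; rewrite -subr_eq0; apply/eqP.
apply: (@metric_nondegenerate _ _ _ g) => Z.
rewrite metric_sym metricDr metricNr -cm_dform.
have := bi_legendrian_dform into12 into21 bl V Z W.
rewrite cm_dform metric_nabla cm_dform => /addrI ->.
by rewrite subrr.
Qed.

(** By flatness [L_xi phi = nabla_xi phi]. *)
Lemma cm_h_eq0 V : cm_h S V = 0.
Proof.
by rewrite /cm_h -!bi_legendrian_xi_lie bi_legendrian_phi subrr scaler0.
Qed.

End FlatPair.

(** * The Tanaka-Webster connection *)

Section TanakaWebster.
Variable D : vfield M -> vfield M -> vfield M.
Hypotheses (lcD : levi_civita g D) (h0 : forall V, cm_h S V = 0).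
Local Notation tw := (tanaka_webster S D).

Lemma tanaka_websterE V W :
  tw V W = D V W + eta V *: phi W + eta W *: phi V + deta V W *: xi.
Proof. by rewrite /tanaka_webster h0 linear0 !addr0. Qed.

Lemma tanaka_webster_metric : metric_connection g tw.
Proof.
have [_ mD _] := lcD; move=> V W Z; rewrite mD !tanaka_websterE !metricE.
rewrite !(metric_sym g xi) !cm_g_xi !(metric_sym g (phi _)) -!cm_dform.
by rewrite (dformC _ Z W) (dformC _ Z V) (dformC _ W V); ring.
Qed.

Lemma tanaka_webster_torsion V W : torsion tw V W = (2 * deta V W) *: xi.
Proof.
have [_ _ tD] := lcD; rewrite /torsion !tanaka_websterE -tD (dformC _ W).
by apply: vfieldP => k; rewrite !vfieldE; ring.
Qed.

End TanakaWebster.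

(** Replacing each bracket [[U, Z]] by [nabla_U Z - nabla_Z U - T (U, Z)], the
    derivatives in the Nijenhuis tensor cancel because [phi] is parallel; the
    torsion terms give [- 2 d eta (phi V, phi W) xi], the others being killed
    by [phi xi = 0]. *)
Lemma parallel_phi_sasakian nabla :
  (forall V W, nabla V (phi W) = phi (nabla V W)) ->
  (forall V W, torsion nabla V W = (2 * deta V W) *: xi) ->
  sasakian S.
Proof.
move=> nphi tor V W.
have lieT U Z : lie U Z = nabla U Z - nabla Z U - (2 * deta U Z) *: xi.
  by rewrite -tor /torsion; apply: vfieldP => k; rewrite !vfieldE; ring.
rewrite !lieT !(linearB, linearZ) /= !phi_xi !linear0 !nphi dform_phi2.
apply: vfieldP => k; rewrite !vfieldE; ring.
Qed.

End Conjugate.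

(** * Coincidence of the two connections *)

Theorem theorem3p1 (R : realType) (n : nat) (M : manifold R n.*2)
  (S : contact_metric M) (L Q : tangent_distribution M)
  (D nabla : vfield M -> vfield M -> vfield M) :
  levi_civita (cm_g S) D ->
  legendrian n (cm_eta S) L ->
  Q = image_distribution (cm_phi S) L ->
  bi_legendrian_connection (cm_eta S) (cm_xi S) L Q nabla ->
  flat_distribution (cm_xi S) L ->
  flat_distribution (cm_xi S) Q ->
  metric_connection (cm_g S) nabla ->
  ((forall V W, nabla V W = tanaka_webster S D V W) <->
   [/\ integrable_distribution L, integrable_distribution Q & sasakian S]).
Proof.
move=> lcD legL QE bl flatL flatQ metric_nabla.
have LQ : legendrian_into S L Q.
  by rewrite QE; exact: legendrian_into_image legL.
have QL : legendrian_into S Q L.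
  by rewrite QE; exact: image_legendrian_into legL.
have h0 := cm_h_eq0 LQ QL bl flatL flatQ metric_nabla.
split=> [nablaE | [intL intQ _]]; last first.
  apply: metric_connection_unique metric_nabla _ _.
    exact: tanaka_webster_metric.
  move=> V W; rewrite (tanaka_webster_torsion lcD h0).
  exact: bi_legendrian_torsion LQ QL bl flatL flatQ _ _ intL intQ.
have tor V W : torsion nabla V W = (2 * dform (cm_eta S) V W) *: cm_xi S.
  by rewrite -(tanaka_webster_torsion lcD h0) /torsion !nablaE.
have integrable L1 L2 : legendrian_into S L1 L2 ->
    bi_legendrian_connection (cm_eta S) (cm_xi S) L1 L2 nabla ->
    integrable_distribution L1.
  move=> L12 bl12 X X' L1X L1X'.
  have -> : lie X X' = nabla X X' - nabla X' X.
    have := tor X X'; rewrite (lsec_dform L12 L1X L1X') mulr0 scale0r.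
    by move/eqP; rewrite subr_eq0 => /eqP.
  by apply: (lsecB L12); apply: (bi_legendrian_preserves L12 bl12).
split; first exact: integrable LQ bl.
- exact: integrable QL (bi_legendrian_sym bl).
- apply: parallel_phi_sasakian tor.
  exact: bi_legendrian_phi LQ QL bl metric_nabla.
Qed.
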